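(* If every ccc poset has property $\mathrm{K}_3$ (the assertion $\mathscr{K}_3$), then $\mathfrak{t}>\omega_1$.
   Context: A poset $\mathcal{P}$ is ccc if every uncountable subset of $\mathcal{P}$ contains two elements with a common lower bound. $\mathcal{P}$ has property $\mathrm{K}_3$ if every uncountable subset of $\mathcal{P}$ has an uncountable subset $X$ such that every $3$-element subset of $X$ has a common lower bound in $\mathcal P$. For $x,y\subseteq\omega$, $x\subseteq^* y$ means that $x\setminus y$ is finite. $[\omega]^\omega$ is the set of infinite subsets of $\omega$. A tower is a family $T=\{t_\alpha\in[\omega]^\omega:\alpha<\kappa\}$, for some cardinal $\kappa$, such that $t_\beta\subseteq^* t_\alpha$ for all $\alpha<\beta<\kappa$. It is filled if there is $t\in[\omega]^\omega$ with $t\subseteq^* t_\alpha$ for all $\alpha<\kappa$. The tower number $\mathfrak{t}$ is the least size of an unfilled tower. *)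

(* Defs.v *)
From HB Require Import structures.
From mathcomp Require Import all_boot all_order.
From mathcomp Require Import boolp classical_sets functions cardinality wochoice.

Set Implicit Arguments.
Unset Strict Implicit.
Unset Printing Implicit Defensive.

Local Open Scope classical_set_scope.
Local Open Scope card_scope.

Definition ccc (d : Order.disp_t) (P : porderType d) : Prop :=
  forall A : set P, ~ countable A ->
    exists x y, [/\ A x, A y, x != y & has_lbound [set x; y]].

Definition property_K3 (d : Order.disp_t) (P : porderType d) : Prop :=
  forall A : set P, ~ countable A ->
    exists X : set P, [/\ X `<=` A, ~ countable X &
      forall F : set P, F `<=` X -> F #= `I_3 -> has_lbound F].

Definition K3_assertion : Prop :=
  forall (d : Order.disp_t) (P : porderType d), ccc P -> property_K3 P.

(* The usual strict part when [R] is a total order. *)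
Definition strict_part (T : Type) (R : rel T) (a b : T) : bool := ~~ R b a.

(* Cardinals as initial ordinals: well-ordered types (with a reflexive order)
   that do not inject into any proper initial segment. *)
Record cardinal := Cardinal {
  csort :> Type;
  cle : rel csort;
  cle_wo : well_order cle;
  cle_initial : forall a : csort,
    ~ ([set: csort] #<= [set b | strict_part cle b a]) }.

Definition cardinal_lt (k l : cardinal) : Prop :=
  [set: k] #<= [set: l] /\ ~ ([set: l] #<= [set: k]).

Definition almost_subset (x y : set nat) : Prop := finite_set (x `\` y).

Definition is_tower (k : cardinal) (t : k -> set nat) : Prop :=
  (forall a, infinite_set (t a)) /\
  (forall a b, strict_part (@cle k) a b -> almost_subset (t b) (t a)).

Definition is_filled (k : cardinal) (t : k -> set nat) : Prop :=
  exists2 x : set nat, infinite_set x & forall a, almost_subset x (t a).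

(* The size of a tower is that of the set of its members; its length [k] may a
   priori be larger. *)
Definition unfilled_tower_size (m : cardinal) : Prop :=
  exists (k : cardinal) (t : k -> set nat),
    [/\ is_tower t, ~ is_filled t & [set: m] #= range t].

Definition is_least_cardinal (Q : cardinal -> Prop) (m : cardinal) : Prop :=
  Q m /\ forall k, Q k -> [set: m] #<= [set: k].

Lemma injective_card_le (T U : Type) (f : T -> U) :
  injective f -> [set: T] #<= [set: U].
Proof.
move=> fI; have fE : range f #= [set: T] by apply: inj_card_eq => x y _ _ /fI.
by rewrite -(card_le_eql fE); exact: card_leT.
Qed.

Lemma least_card_ex (I : Type) (F : I -> Type) (i0 : I) :
  exists i, forall j, [set: F i] #<= [set: F j].
Proof.
pose P (Y : set (forall i, F i)) :=
  forall i x y, Y x -> Y y -> x i = y i -> x = y.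
have [|Y [PY maxY]] := @Zorn_bigcup _ P.
  move=> G GP Gtot i x y [A GA Ax] [B GB By].
  by have [AB|BA] := Gtot _ _ GA GB; [apply: (GP _ GB); auto|apply: (GP _ GA); auto].
have [[i surj]|nsurj] :=
    pselect (exists i, forall a : F i, exists2 x, Y x & x i = a).
  exists i => j.
  pose s a := s2val (cid2 (surj a)).
  have sY a : Y (s a) by rewrite /s; case: cid2.
  have sE a : s a i = a by rewrite /s; case: cid2.
  by apply: (@injective_card_le _ _ (fun a => s a j)) => a b sab;
     rewrite -(sE a) -(sE b) (PY _ _ _ (sY a) (sY b) sab).
have nP i : exists a : F i, forall x, Y x -> x i <> a.
  apply: contra_notP nsurj => /forallNP H; exists i => a.
  have /existsNP[x /not_implyP[Yx /contrapT xa]] := H a.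
  by exists x.
pose z i := sval (cid (nP i)).
have zP i x : Y x -> x i <> z i by rewrite /z; case: cid => a /= /[apply].
exfalso; apply: (maxY (Y `|` [set z])).
  split; first by move=> x; left.
  by move=> /(_ z (or_intror erefl)) /(zP i0)/(_ erefl).
move=> i x y [Yx|->] [Yy|->] //; first exact: PY.
- by move=> /(zP i _ Yx).
- by move=> /esym /(zP i _ Yy).
Qed.

Lemma card_le_total (T U : Type) : [set: T] #<= [set: U] \/ [set: U] #<= [set: T].
Proof.
have [[] H] := @least_card_ex bool (fun b => if b then T else U) true.
- by left; exact: (H false).
- by right; exact: (H true).
Qed.

Lemma card_sig (T : Type) (S : set T) : [set: {x | S x}] #= S.
Proof.
have vS : range (fun u : {x | S x} => sval u) = S.
  by apply/seteqP; split=> [_ [[x Sx] _ <-]//|x Sx]; exists (exist _ x Sx).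
have : range (fun u : {x | S x} => sval u) #= [set: {x | S x}].
  by apply: inj_card_eq => -[x Sx] [y Sy] _ _ /= xy; exact: eq_exist.
by rewrite vS card_eq_sym.
Qed.

Lemma least_cardinal_ex (Q : cardinal -> Prop) :
  (exists k, Q k) -> exists m, is_least_cardinal Q m.
Proof.
move=> [k0 Qk0].
pose J := {A : set k0 | exists2 k : cardinal, Q k & A #= [set: k]}.
have j0 : J by exists setT, k0.
have [[A [m Qm Am]] /= mP] := @least_card_ex J (fun D => {x | sval D x}) j0.
exists m; split=> // k Qk; rewrite -(card_le_eql Am).
have [/card_subP[B Bk _]|k0k] := card_le_total k k0.
  have := mP (exist _ B (ex_intro2 _ _ k Qk Bk)).
  by rewrite /= (card_le_eql (card_sig _)) (card_le_eqr (card_sig _)) (card_le_eqr Bk).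
by apply: card_le_trans k0k; exact: card_leT.
Qed.

Lemma well_order_min (T : Type) (R : rel T) (S : set T) : well_order R ->
  S !=set0 -> exists2 z, S z & forall x, S x -> R z x.
Proof.
move=> Rwo [x Sx]; have [|z [[zS zP] _]] := Rwo (mem S).
  by exists x; rewrite inE.
exists z => [|y Sy]; first exact/set_mem.
by apply: zP; rewrite inE.
Qed.

Lemma well_order_total (T : Type) (R : rel T) : well_order R -> total R.
Proof.
move=> Rwo x y.
have [|z [->|->] zP] := @well_order_min _ _ [set x; y] Rwo.
- by exists x; left.
- by rewrite zP //; right.
- by rewrite (zP x) ?orbT//; left.
Qed.

Lemma well_order_anti (T : Type) (R : rel T) : well_order R -> antisymmetric R.
Proof.
move=> Rwo x y /andP[Rxy Ryx].
have Rr u : R u u by have := well_order_total Rwo u u; rewrite orbb.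
have [|z [_ zP]] := Rwo (mem [set x; y]); first by exists x; rewrite inE; left.
have <- : z = x.
  by apply: zP; split=> [|u]; rewrite inE; [left|case=> ->].
by apply: zP; split=> [|u]; rewrite inE; [right|case=> ->].
Qed.

Lemma well_order_ex (T : Type) : exists R : rel T, well_order R.
Proof.
by elim/Peq: T => T; have [R Rwo] := well_ordering_principle T; exists R.
Qed.

Lemma well_order_relpre (T U : Type) (f : U -> T) (R : rel T) :
  injective f -> well_order R -> well_order (relpre f R).
Proof.
move=> fI Rwo; apply: antisymmetric_well_order.
  by move=> x y /= /(well_order_anti Rwo)/fI.
move=> A [x Ax].
have [|_ [z Az <-] zP] := @well_order_min _ _ (f @` [set` A]) Rwo.
  by exists (f x); exists x.
by exists z; split=> // y Ay; apply: zP; exists y.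
Qed.

Lemma sub_cardinal_ex (T : Type) (R : rel T) (S : set T) : well_order R ->
  (forall a, S a -> ~ (S #<= [set b | strict_part R b a])) ->
  exists k : cardinal, exists f : k -> T, [/\ injective f, range f = S &
    forall a b, strict_part (@cle k) a b = strict_part R (f a) (f b)].
Proof.
move=> Rwo Sinit.
have vI : injective (fun u : {x | S x} => sval u).
  by move=> [x Sx] [y Sy] /= xy; exact: eq_exist.
have vS : range (fun u : {x | S x} => sval u) = S.
  by apply/seteqP; split=> [_ [[x Sx] _ <-]//|x Sx]; exists (exist _ x Sx).
have vC : S #= [set: {x | S x}].
  rewrite card_eq_sym; exact: card_sig.
unshelve eexists (@Cardinal {x | S x} _ (well_order_relpre vI Rwo) _).
  move=> [a Sa]; rewrite -(card_le_eql vC) => H; apply: (Sinit _ Sa).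
  apply: card_le_trans H _.
  have E : sval @` [set b : {x | S x} |
      strict_part (relpre (fun u : {x | S x} => sval u) R) b (exist _ a Sa)] #=
    [set b : {x | S x} |
      strict_part (relpre (fun u : {x | S x} => sval u) R) b (exist _ a Sa)].
    by apply: inj_card_eq => x y _ _ /vI.
  by rewrite -(card_le_eql E); apply: subset_card_le => _ [[b Sb] /= ? <-].
by exists (fun u => sval u).
Qed.

Lemma cardinal_of (T : Type) : exists k : cardinal, [set: k] #= [set: T].
Proof.
have [R Rwo] := well_order_ex T.
suff [S ST Sinit] : exists2 S : set T, [set: T] #<= S &
    forall a, S a -> ~ (S #<= [set b | strict_part R b a]).
  have [k [f [fI fS _]]] := sub_cardinal_ex Rwo Sinit; exists k.
  have fC : range f #= [set: k] by apply: inj_card_eq => x y _ _ /fI.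
  rewrite -(card_eql fC) fS card_eq_le ST andbT; exact: card_leT.
have [[a Ba]|nB] :=
    pselect (exists a, [set: T] #<= [set b | strict_part R b a]); last first.
  by exists [set: T] => // a _ H; apply: nB; exists a.
have [|z zB zP] :=
    @well_order_min _ _ [set a | [set: T] #<= [set b | strict_part R b a]] Rwo.
  by exists a.
exists [set b | strict_part R b z] => // c /= cz H.
by move: cz; rewrite /strict_part zP //=; exact: card_le_trans zB H.
Qed.

Lemma almost_subset_trans (x y z : set nat) :
  almost_subset x y -> almost_subset y z -> almost_subset x z.
Proof.
move=> xy yz; apply: (@sub_finite_set _ _ ((x `\` y) `|` (y `\` z))).
  by move=> n [xn zn]; have [yn|yn] := pselect (y n); [right|left].
by rewrite finite_setU.
Qed.

Lemma almost_subset_refl (x : set nat) : almost_subset x x.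
Proof. by rewrite /almost_subset setDv. Qed.

Lemma infinite_split (x : set nat) : infinite_set x -> exists y : set nat,
  [/\ infinite_set y, y `<=` x & ~ almost_subset x y].
Proof.
move=> /infiniteP/ppcard_leP[f].
have fI : injective f by move=> a b E; apply: (@inj _ _ _ f) => //; rewrite inE.
have rI (g : nat -> nat) : injective g -> infinite_set (range g).
  move=> gI; apply/infiniteP.
  have /card_eqPle[] // : range g #= [set: nat].
  by apply: inj_card_eq => a b _ _ /gI.
exists (range (fun n => f n.*2)); split.
- by apply: rI => a b /fI /double_inj.
- by move=> _ [n _ <-]; exact: funS.
- apply: (@sub_infinite_set _ (range (fun n => f n.*2.+1))).
    move=> _ [n _ <-]; split; first exact: funS.
    by move=> [m _ /fI /(congr1 odd)]; rewrite /= !odd_double.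
  by apply: rI => a b /fI [] /double_inj.
Qed.

Lemma unfilled_tower_ex :
  exists (k : cardinal) (t : k -> set nat), is_tower t /\ ~ is_filled t.
Proof.
pose P (C : set (set nat)) := (forall x, C x -> infinite_set x) /\
  forall x y, C x -> C y -> almost_subset x y \/ almost_subset y x.
have [|C [[Cinf Ctot] maxC]] := @Zorn_bigcup _ P.
  move=> G GP Gtot; split=> [x [A GA Ax]|x y [A GA Ax] [B GB By]].
    exact: (GP _ GA).1.
  by have [AB|BA] := Gtot _ _ GA GB;
     [apply: (GP _ GB).2; auto|apply: (GP _ GA).2; auto].
have Cunf x : infinite_set x -> ~ forall c, C c -> almost_subset x c.
  move=> xinf xC; have [y [yinf yx xy]] := infinite_split xinf.
  have yC c : C c -> almost_subset y c.
    move=> /xC; apply: almost_subset_trans.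
    by apply: (sub_finite_set (B := set0)) => // n [/yx].
  apply: (maxC (C `|` [set y])).
    split; first by move=> z; left.
    by move=> /(_ y (or_intror erefl)) /xC.
  split=> [z [/Cinf|->]//|z w [Cz|->] [Cw|->]].
  - exact: Ctot.
  - by right; exact: yC.
  - by left; exact: yC.
  - by left; exact: almost_subset_refl.
pose coinitial (D : set (set nat)) := D `<=` C /\
  forall c, C c -> exists2 e, D e & almost_subset e c.
have CC : coinitial C.
  by split=> // c Cc; exists c => //; exact: almost_subset_refl.
have [[D [DC Dcoi]] /= Dmin] := @least_card_ex {D | coinitial D}
  (fun D => {x | sval D x}) (exist _ C CC).
have sigE (E : set (set nat)) : [set: {x | E x}] #= E.
  exact: card_sig.
have [k kD] := cardinal_of {x | D x}.
have {}kD : [set: k] #= D by exact: card_eq_trans kD (sigE D).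
have /card_set_bijP[f [fD _ fsurj]] := kD.
pose S := [set a : k | forall b, strict_part (@cle k) b a ->
  ~ almost_subset (f b) (f a)].
have Scoi : coinitial (f @` S).
  split=> [_ [a _ <-]|c Cc]; first by apply: DC; exact: fD.
  have [e De ec] := Dcoi _ Cc; have [a _ fa] := fsurj _ De.
  have [|z zc zP] := @well_order_min _ _
    [set a | almost_subset (f a) c] (@cle_wo k); first by exists a; rewrite /= fa.
  exists (f z) => //; exists z => // b bz bfz.
  by move: bz; rewrite /strict_part zP //=; exact: almost_subset_trans bfz zc.
have kS : [set: k] #<= S.
  rewrite (card_le_eql kD); apply: card_le_trans (card_image_le f S).
  have := Dmin (exist _ _ Scoi) => /=.
  by rewrite (card_le_eql (sigE _)) (card_le_eqr (sigE _)).
have [a Sa H|K [g [gI gS gE]]] := @sub_cardinal_ex _ _ S (@cle_wo k).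
  exact: (@cle_initial k a (card_le_trans kS H)).
have Sg a : S (g a) by move: gS => /seteqP[+ _]; apply; exists a.
have Cfg a : C (f (g a)) by apply: DC; exact: fD.
exists K, (f \o g); split.
  split=> [a|a b]; first by apply: Cinf; exact: Cfg.
  rewrite gE => /(Sg b) nab.
  by have [//|] := Ctot _ _ (Cfg b) (Cfg a).
move=> [x xinf xP]; apply: (Cunf x xinf) => c /Scoi.2 [_ [a Sa <-]].
apply: almost_subset_trans; move: Sa; rewrite -gS => -[b _ <-]; exact: xP.
Qed.

Lemma unfilled_tower_size_ex : exists m, unfilled_tower_size m.
Proof.
have [k [t [tT tU]]] := unfilled_tower_ex.
have [m mE] := cardinal_of (range t).
by exists m, k, t; split=> //; apply: card_eq_trans mE _; exact: card_setT.
Qed.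

Lemma uncountable_cardinal_ex : exists k : cardinal, ~ countable [set: k].
Proof.
have [k kE] := cardinal_of (set nat); exists k.
rewrite /countable (card_le_eql kE) => /pcard_injP[h hI].
pose A := [set n | exists2 B : set nat, h B = n & ~ B n].
have [Ah|nAh] := pselect (A (h A)); last by apply: (nAh); exists A.
by case: (Ah) => B /hI; rewrite !inE => /(_ I I) ->.
Qed.

Definition omega1 : cardinal :=
  sval (cid (least_cardinal_ex uncountable_cardinal_ex)).

Definition tower_number : cardinal :=
  sval (cid (least_cardinal_ex unfilled_tower_size_ex)).

(* Main.v *)
Require Import Defs.
From HB Require Import structures.
From mathcomp Require Import all_boot all_order finmap.
From mathcomp Require Import boolp classical_sets functions cardinality.
From mathcomp Require Import zify.

Set Implicit Arguments.
Unset Strict Implicit.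
Unset Printing Implicit Defensive.

Import Order.TTheory.

Local Open Scope classical_set_scope.

(** The theorem follows from one ccc poset attached to a decreasing sequence
    [s a], [a < omega1], of infinite sets of naturals.

    The poset uses coherent finite-to-one functions: [r a] is a finite-to-one
    function from the predecessors of [a] to the naturals, and for [a < b] the
    functions [r a] and [r b] only differ at places where both take values at
    most [r b a] ([coherent_finite_to_one]). For [k] a natural, say that [x] and
    [y] meet at [k] if the first elements from [k] on of [s x] and of [s y] are
    such that the larger one is in both sets ([meet_next]). Two members of the
    sequence meet at every large [k]. A condition is a finite set [F] of
    indices such that whenever [x], [y] in [F] agree at [z] and a third element
    [b] of [F] disagrees with them there, [x] and [y] meet at the larger of the
    two values ([compatible]). Conditions are ordered by reverse inclusion.

    The poset is ccc ([condition_ccc]): each condition [F] has a bound [K] for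
    the values of [r] on its pairs, chosen so large that all its members meet
    from [K] on. Thin out an uncountable family by a Delta-system argument on
    the finitely many places where some member of [F] has a value at most [K],
    and by stabilizing countably many data. For two remaining conditions, a
    requirement on their union at a value above [K] is handled by the choice of
    [K] or by coherence; the other ones happen at a place of the root, where an
    element of one condition can be replaced by a copy in the other.

    The property K_3 only needs to be applied to singletons: three indices
    whose singletons have a common lower bound satisfy the requirement above.
    So there is an uncountable [X] all of whose triples satisfy it
    ([uncountable_compatible_ex]). Members of [X] disagree at infinitely many
    places, since otherwise they would define a single function that is both
    finite-to-one below each index and constant on an uncountable set
    ([infinite_splitting]). Let [a] be above infinitely many such places.
    Coherence with [r a] gives an uncountable [Y] contained in [X] whose members
    agree with [r a] at all but finitely many places below [a], so all pairs in
    [Y] meet at a common [k], for unboundedly many [k] ([compatible_meets]).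
    From this a set almost contained in all [s x], [x] in [Y], is read off
    ([pseudo_intersection_of_meets]); since [Y] is cofinal, it is almost
    contained in every [s a].

    Finally, if the tower number were at most omega_1, the members of an
    unfilled tower could be listed along omega_1, and either countably many of
    them are coinitial or they have a coinitial decreasing omega_1-sequence; in
    both cases the tower is filled ([comparable_pseudo_intersection]). *)

(** * Countability, infinity and Delta-systems *)

Lemma subset_countable (T : Type) (A B : set T) :
  A `<=` B -> countable B -> countable A.
Proof. by move=> /subset_card_le; exact: sub_countable. Qed.

Lemma countable_setU (T : Type) (A B : set T) :
  countable A -> countable B -> countable (A `|` B).
Proof.
move=> Ac Bc; rewrite -bigcup2E; apply: bigcup_countable => //.
by move=> [|[|i]] _ //=; exact: countable0.
Qed.

Lemma uncountable_fibre (T : Type) (D : countType) (A : set T) (f : T -> D) :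
  ~ countable A -> exists d, ~ countable [set x | A x /\ f x = d].
Proof.
move=> Auc; apply: contra_notP Auc => /forallNP H.
apply: (@subset_countable _ _ (\bigcup_d [set x | A x /\ f x = d])).
  by move=> x Ax; exists (f x).
by apply: bigcup_countable => // d _; apply: contrapT.
Qed.

Lemma uncountable_neq0 (T : Type) (A : set T) : ~ countable A -> A !=set0.
Proof.
by move=> Auc; apply/set0P/eqP => A0; apply: Auc; rewrite A0; exact: countable0.
Qed.

Lemma uncountable_setD (T : Type) (A B : set T) :
  ~ countable A -> countable B -> ~ countable (A `\` B).
Proof.
move=> Auc Bc /countable_setU/(_ Bc) H; apply: Auc; apply: subset_countable H.
by move=> x Ax; have [|] := pselect (B x); [right|left].
Qed.

Lemma infinite_enum (T : Type) (A : set T) : infinite_set A ->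
  exists f : nat -> T, injective f /\ forall n, A (f n).
Proof.
elim/Ppointed: T => T in A *; first by rewrite emptyE_subdef.
move=> /infiniteP/pcard_leP[f]; exists f; split=> [a b E|n]; last exact: funS.
by apply: (@inj _ _ _ f) => //; rewrite inE.
Qed.

Lemma injective_infinite (T : Type) (A : set T) (f : nat -> T) :
  injective f -> (forall n, A (f n)) -> infinite_set A.
Proof.
move=> fI fA; apply: (@sub_infinite_set _ (range f)) => [_ [n _ <-]//|].
apply/infiniteP.
by have /card_eqPle[] // : (range f #= [set: nat])%card
  by apply: inj_card_eq => a b _ _ /fI.
Qed.

Lemma infinite_natP (A : set nat) :
  infinite_set A <-> forall N, exists2 n, N <= n & A n.
Proof.
split=> [Ainf N|Aunb /finite_seqP[l Al]].
  apply: contra_notP Ainf => /forall2NP H; apply: (@sub_finite_set _ _ `I_N).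
    by move=> n An; have [/negP|//] := H n; rewrite -ltnNge.
  exact: finite_II.
have [n nl An] := Aunb (\max_(i <- l) i).+1.
have : n \in l by move: An; rewrite Al.
by move=> nl'; have := @leq_bigmax_seq _ l xpredT id n nl' isT; rewrite leqNgt nl.
Qed.

(** A root [r] of maximal size among those contained in [h x] for uncountably
    many [x], once the size of [h x] is fixed: a point outside [r] that lay in
    uncountably many [h x] could be added to [r]. *)
Lemma uncountable_root (T : Type) (W : eqType) (h : T -> seq W) (A : set T) :
  ~ countable A ->
  exists (r : seq W) (J : set T), [/\ J `<=` A, ~ countable J &
    forall w, w \notin r -> countable [set x | J x /\ w \in h x]].
Proof.
move=> Auc; have [n] := uncountable_fibre (fun x => size (h x)) Auc.
set J0 := (X in ~ countable X) => J0uc.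
(* [m] exceeds the number of points that can still be added to [r]. *)
suff H m (r : seq W) J : n < size r + m -> J `<=` J0 -> ~ countable J ->
    uniq r -> (forall x, J x -> {subset r <= h x}) ->
    exists (r : seq W) (J : set T), [/\ J `<=` J0, ~ countable J &
      forall w, w \notin r -> countable [set x | J x /\ w \in h x]].
  have [//|//|//|//|//|r [J [JJ0 Juc rP]]] := H n.+1 [::] J0.
  by exists r, J; split=> // x /JJ0[].
elim: m r J => [|m IH] r J.
  rewrite addn0 => nr JJ0 /uncountable_neq0[x Jx] ru rh.
  by have := uniq_leq_size ru (rh _ Jx); have [_ ->] := JJ0 _ Jx; lia.
move=> nr JJ0 Juc ru rh.
have [H|/existsNP[w /not_implyP[wr wuc]]] :=
    pselect (forall w, w \notin r -> countable [set x | J x /\ w \in h x]).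
  by exists r, J.
apply: (IH (w :: r) [set x | J x /\ w \in h x]) => //=.
- by rewrite addSnnS.
- by move=> x [/JJ0].
- by rewrite wr.
- by move=> x [Jx wx] v; rewrite inE => /predU1P[->|/(rh _ Jx)].
Qed.

(** The weak form of the Delta-system lemma in which the intersections are only
    contained in the root. It leaves [J] free to be thinned out by data that
    depend on the root. *)
Lemma uncountable_delta (T : Type) (W : eqType) (h : T -> seq W) (A : set T) :
  ~ countable A ->
  exists (r : seq W) (J : set T), [/\ J `<=` A, ~ countable J &
    forall J' : set T, J' `<=` J -> ~ countable J' ->
      exists x y, [/\ J' x, J' y, x <> y &
        forall w, w \in h x -> w \in h y -> w \in r]].
Proof.
move=> /(uncountable_root h)[r [J [JA Juc rP]]]; exists r, J; split=> // J' J'J J'uc.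
have [x J'x] := uncountable_neq0 J'uc.
pose B := \bigcup_(w in [set` [seq w <- h x | w \notin r]])
  [set y | J y /\ w \in h y].
have Bc : countable (B `|` [set x]).
  apply: countable_setU; last exact: countable1.
  apply: bigcup_countable; first exact/finite_set_countable/finite_seq.
  by move=> w /=; rewrite mem_filter => /andP[/rP].
have [y [J'y yB]] := uncountable_neq0 (uncountable_setD J'uc Bc).
exists x, y; split=> // [xy|w wx wy]; first by apply: yB; right.
apply: contrapT => /negP wr; apply: yB; left; exists w => //=.
  by rewrite mem_filter wr.
by split=> //; exact: J'J.
Qed.

(** * Coherent finite-to-one functions *)

Section CoherentFunctions.
Context {d : Order.disp_t} {W : orderType d}.
Hypothesis W_wf : well_founded (fun x y : W => (x < y)%O).
Hypothesis W_segment : forall a : W, countable [set x | (x < a)%O].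

(** The running maximum of an enumeration of the predecessors of [a]; [k x] is
    the first step of this sequence that passes [x]. *)
Lemma cofinal_sequence (a : W) : exists (b : nat -> W) (k : W -> nat),
  {homo b : i j / i <= j >-> (i <= j)%O} /\
  forall x, (x < a)%O -> [/\ forall i, (b i < a)%O, (x <= b (k x))%O &
                            forall i, (x <= b i)%O -> k x <= i].
Proof.
have [[x0 x0a]|nx] := pselect (exists x, (x < a)%O); last first.
  exists (fun=> a), (fun=> 0); split=> // x xa.
  by exfalso; apply: nx; exists x.
have /countable_injP[f fI] := W_segment a.
pose c n := if pselect (exists2 x, (x < a)%O & f x = n) is left h
  then s2val (cid2 h) else x0.
have ca n : (c n < a)%O by rewrite /c; case: pselect => // h; case: cid2.
have cf x : (x < a)%O -> c (f x) = x.
  move=> xa; rewrite /c; case: pselect => [h|[]]; last by exists x.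
  by case: cid2 => y /= ya /fI; rewrite !inE; exact.
pose b := fix b n := if n is m.+1 then Order.max (b m) (c m.+1) else c 0.
have ba n : (b n < a)%O by elim: n => [|n IH] //=; rewrite gt_max IH ca.
have cb n : (c n <= b n)%O by case: n => [|n] //=; rewrite le_max lexx orbT.
have bmono : {homo b : i j / i <= j >-> (i <= j)%O}.
  apply: homo_leq => [x|y x z|n] //=; first exact: le_trans.
  by rewrite le_max lexx.
have bx x : exists n, (x < a)%O ==> (x <= b n)%O.
  by exists (f x); apply/implyP => /cf {1}<-.
exists b, (fun x => ex_minn (bx x)); split=> // x xa; split=> //.
  by case: ex_minnP => n; rewrite xa.
by move=> i xi; case: ex_minnP => n _; apply; rewrite xi implybT.
Qed.

(** By recursion along [b a], the sequence of [cofinal_sequence]: the value of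
    [r a] at [x] is the larger of the value of [r (b a l)] at [x], where [b a l]
    is the first term above [x], and of [M r a l], which bounds [l] and the
    values of [r] on pairs among the first terms. Including [l] makes [r a]
    finite-to-one, since only finitely many [l] are below a given value; the
    values on pairs give the two ultrametric inequalities in [tri], of which
    coherence is a formal consequence. *)
Lemma coherent_finite_to_one : exists r : W -> W -> nat,
  (forall a n, finite_set [set x | (x < a)%O /\ r a x <= n]) /\
  forall x a b, (x < a)%O -> (a < b)%O -> r a x <> r b x ->
    maxn (r a x) (r b x) <= r b a.
Proof.
have [b /choice[k bk]] := choice cofinal_sequence.
pose M (r : W -> W -> nat) a l :=
  \max_(j < l.+1) maxn j (\max_(i < j.+1) r (b a j) (b a i)).
(* The recursive call is extended by [0] so that [M] can be applied to it. *)
pose step a (rec : forall c, (c < a)%O -> W -> nat) x :=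
  let r c := if pselect (c < a)%O is left ca then rec c ca else fun=> 0 in
  if x == a then 0 else maxn (r (b a (k a x)) x) (M r a (k a x)).
pose r := Fix W_wf (fun=> W -> nat) step.
have r_unfold a : r a = step a (fun c _ => r c).
  rewrite {1}/r Fix_eq // => c f g fg; congr (step _ _).
  by apply: functional_extensionality_dep => y; apply: functional_extensionality_dep.
have bmono a : {homo b a : i j / i <= j >-> (i <= j)%O} := (bk a).1.
have ba a x i : (x < a)%O -> (b a i < a)%O by move=> /(bk a).2[].
have xb a x : (x < a)%O -> (x <= b a (k a x))%O by move=> /(bk a).2[].
have kmin a x i : (x < a)%O -> (x <= b a i)%O -> k a x <= i.
  by move=> /(bk a).2[_ _]; exact.
have raa a : r a a = 0 by rewrite r_unfold /step eqxx.
have rE a x : (x < a)%O -> r a x = maxn (r (b a (k a x)) x) (M r a (k a x)).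
  move=> xa; rewrite {1}r_unfold /step lt_eqF //.
  pose r' c := if pselect (c < a)%O is left _ then r c else fun=> 0.
  rewrite -[LHS]/(maxn (r' (b a (k a x)) x) (M r' a (k a x))).
  have r'E i : r' (b a i) = r (b a i).
    by rewrite /r'; case: pselect => // -[]; exact: ba xa.
  rewrite r'E; congr maxn; apply: eq_bigr => j _; congr maxn.
  by apply: eq_bigr => i _; rewrite r'E.
have M_ge a l : l <= M r a l.
  by apply: leq_trans (leq_bigmax ord_max); rewrite leq_max leqnn.
have M_mono a i j : i <= j -> M r a i <= M r a j.
  move=> ij; apply/bigmax_leqP => l _.
  have lj : l < j.+1 by have := ltn_ord l; lia.
  exact: (leq_bigmax (Ordinal lj)).
have M_r a i j : i <= j -> r (b a j) (b a i) <= M r a j.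
  move=> ij; apply: leq_trans (leq_bigmax ord_max); rewrite leq_max /=.
  by apply/orP; right; exact: (leq_bigmax (Ordinal (ij : i < j.+1))).
have tri a x y : (x <= y)%O -> (y <= a)%O ->
    r a x <= maxn (r y x) (r a y) /\ r y x <= maxn (r a x) (r a y).
  elim/(well_founded_ind W_wf) : a x y => a IH x y xy.
  rewrite le_eqVlt => /predU1P[->|ya].
    by rewrite raa maxn0 !leqnn.
  have xa := le_lt_trans xy ya.
  have kxy : k a x <= k a y.
    by apply: kmin => //; apply: le_trans xy _; exact: xb.
  rewrite (rE _ _ xa) (rE _ _ ya).
  (* Both inequalities are transported to [b a (k a y)], which is below [a], and
     compared there with the earlier term [b a (k a x)]. *)
  have [H1 H2] := IH _ (ba a y (k a y) ya) x y xy (xb _ _ ya).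
  have [H3 H4] := IH _ (ba a y (k a y) ya) x _ (xb _ _ xa) (bmono _ _ _ kxy).
  have := M_mono a _ _ kxy; have := M_r a _ _ kxy.
  by split; lia.
exists r; split=> [a n|x a c xa ac].
  elim/(well_founded_ind W_wf) : a => a IH.
  apply: (@sub_finite_set _ _ (\bigcup_(l in `I_n.+1)
    (if (b a l < a)%O
     then [set b a l] `|` [set x | (x < b a l)%O /\ r (b a l) x <= n]
     else set0))).
    move=> x /= [xa]; rewrite rE // geq_max => /andP[xr lM].
    exists (k a x); first by rewrite /= ltnS; apply: leq_trans lM; exact: M_ge.
    rewrite (ba _ _ _ xa); have := xb _ _ xa; rewrite le_eqVlt => /predU1P[?|?].
      by left.
    by right.
  apply: bigcup_finite => [|l _]; first exact: finite_II.
  by case: ifPn => // la; rewrite finite_setU; split=> //; exact: IH.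
by have [H1 H2] := tri c x a (ltW xa) (ltW ac); lia.
Qed.

End CoherentFunctions.

(** * Common elements of two sets of naturals *)

(** The first element of [a] from [k] on; [a] is meant to be infinite. *)
Definition next (a : set nat) (k : nat) : nat :=
  if pselect (exists n, `[< k <= n /\ a n >]) is left h then ex_minn h else k.

Lemma nextP (a : set nat) k : infinite_set a ->
  [/\ k <= next a k, a (next a k) & forall n, k <= n -> a n -> next a k <= n].
Proof.
move=> /infinite_natP/(_ k)[m km am]; rewrite /next.
case: pselect => [h|[]]; last by exists m; apply/asboolP.
case: ex_minnP => n /asboolP[kn an] nmin; split=> // i ki ai.
by apply: nmin; apply/asboolP.
Qed.

(** This only depends on finitely many elements of [a] and [b], while its truth
    for unboundedly many [k] yields an infinite intersection: this is what
    makes it usable as a finite approximation to [a] and [b] having a common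
    almost subset. *)
Definition meet_next (k : nat) (a b : set nat) : Prop :=
  a (maxn (next a k) (next b k)) /\ b (maxn (next a k) (next b k)).

Lemma meet_next_refl k a : infinite_set a -> meet_next k a a.
Proof. by move=> /(nextP k)[_ ak _]; rewrite /meet_next maxnn. Qed.

Lemma meet_nextC k a b : meet_next k a b -> meet_next k b a.
Proof. by rewrite /meet_next maxnC => -[]. Qed.

Lemma meet_next_eventually a b : infinite_set a -> infinite_set b ->
  almost_subset b a -> exists m, forall k, m <= k -> meet_next k a b.
Proof.
move=> ainf binf /finite_seqP[l ba].
exists (\max_(i <- l) i).+1 => k mk.
have {}ba n : k <= n -> b n -> a n.
  move=> kn bn; apply: contrapT => an.
  have nl : n \in l by have : (b `\` a) n by []; rewrite ba.
  by have := @leq_bigmax_seq _ l xpredT id n nl isT; lia.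
have [ka aa amin] := nextP k ainf; have [kb bb bmin] := nextP k binf.
have := amin _ kb (ba _ kb bb) => /maxn_idPr E.
by rewrite /meet_next E; split=> //; exact: ba.
Qed.

(** The finite part of [b] that decides whether [a] and [b] meet at [k] can be
    shared by another set. *)
Lemma meet_next_trace k m a b c : infinite_set b -> infinite_set c ->
  next a k < m -> next b k < m -> (forall n, n < m -> b n <-> c n) ->
  meet_next k a b -> meet_next k a c.
Proof.
move=> binf cinf am bm bc.
have [kb bb bmin] := nextP k binf; have [kc cc cmin] := nextP k cinf.
have cb : next c k <= next b k by apply: cmin => //; apply/bc.
rewrite /meet_next; have E : next b k = next c k.
  apply/eqP; rewrite eqn_leq cb andbT; apply: bmin => //; apply/bc => //.
  exact: leq_ltn_trans bm.
by rewrite -E => -[Ha Hb]; split=> //; apply/bc => //; rewrite gtn_max am.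
Qed.

(** * The poset of compatible finite sets *)

Section Forcing.
Context {d : Order.disp_t} {W : orderType d}.
Variables (r : W -> W -> nat) (s : W -> set nat).

(** A disagreement at [z] between [x], [y] and a third element [b] promises that
    [s x] and [s y] meet at a value that tends to infinity with [z]. Only
    triples are constrained, which is why property K_3 is the right strength. *)
Definition compatible (X : set W) : Prop := forall x y b z,
  X x -> X y -> X b -> (z < x)%O -> (z < y)%O -> (z < b)%O ->
  r x z = r y z -> r x z <> r b z ->
  meet_next (maxn (r x z) (r b z)) (s x) (s y).

Definition condition : Type := {F : {fset W} | `[< compatible [set` F] >]}.

HB.instance Definition _ :=
  Choice.copy condition {F : {fset W} | `[< compatible [set` F] >]}.

Definition extends (F G : condition) : bool := (sval G `<=` sval F)%fset.

Lemma extends_refl : reflexive extends.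
Proof. by move=> F; exact: fsubset_refl. Qed.

Lemma extends_anti : antisymmetric extends.
Proof.
by move=> F G /andP[GF FG]; apply/val_inj/eqP; rewrite eqEfsubset; apply/andP.
Qed.

Lemma extends_trans : transitive extends.
Proof. by move=> F G H FG HF; exact: fsubset_trans HF FG. Qed.

HB.instance Definition _ := Order.Le_isPOrder.Build (Order.Disp tt tt) condition
  extends_refl extends_anti extends_trans.

Hypothesis r_finite : forall a n, finite_set [set z | (z < a)%O /\ r a z <= n].
Hypothesis r_coherent : forall z a b, (z < a)%O -> (a < b)%O ->
  r a z <> r b z -> maxn (r a z) (r b z) <= r b a.
Hypothesis s_infinite : forall a, infinite_set (s a).
Hypothesis s_decreasing : forall a b, (a < b)%O -> almost_subset (s b) (s a).

(** * The countable chain condition *)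

Definition bounded_by (K : nat) (F : {fset W}) : Prop :=
  forall x y, x \in F -> y \in F ->
    r x y <= K /\ forall k, K <= k -> meet_next k (s x) (s y).

Lemma bounded_by_ex (F : {fset W}) : exists K, bounded_by K F.
Proof.
have m_ex (p : W * W) : exists m, forall k, m <= k -> meet_next k (s p.1) (s p.2).
  case: p => x y /=.
  have [xy|yx|->] := ltgtP x y;
    last by exists 0 => k _; exact: (meet_next_refl _ (@s_infinite _)).
    by apply: meet_next_eventually => //; exact: s_decreasing.
  have [m mP] :=
    meet_next_eventually (@s_infinite y) (@s_infinite x) (s_decreasing yx).
  by exists m => k /mP ?; exact: meet_nextC.
have [m mP] := choice m_ex.
pose M x := \max_(y <- F) maxn (r x y) (m (x, y)).
exists (\max_(x <- F) M x) => x y xF yF.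
have : maxn (r x y) (m (x, y)) <= \max_(x <- F) M x.
  apply: (leq_trans _ (leq_bigmax_seq x xF isT)).
  exact: (leq_bigmax_seq y yF isT).
rewrite geq_max => /andP[rK mK]; split=> // k Kk; apply: (mP (x, y)).
exact: leq_trans mK Kk.
Qed.

(** From the point of view of [root] and of the naturals below [m], the indices
    [x] and [y] are copies of each other. *)
Definition same_trace (root : seq W) (m : nat) (x y : W) : Prop :=
  (forall z, z \in root -> (z < x)%O = (z < y)%O /\ r x z = r y z) /\
  (forall n, n < m -> s x n <-> s y n).

Section Amalgamation.
Variables (K m : nat) (root : seq W) (F G : {fset W}).
Hypothesis F_compatible : compatible [set` F].
Hypothesis F_bounded : bounded_by K F.
Hypothesis F_next : forall x k, x \in F -> k <= K -> next (s x) k < m.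
Hypothesis FG_root : forall x y z, x \in F -> y \in G ->
  (z < x)%O -> (z < y)%O -> r x z <= K -> r y z <= K -> z \in root.
Hypothesis GF_trace : forall y, y \in G ->
  exists2 y', y' \in F & same_trace root m y y'.

(** If the two values exceed [K], [x] and [y] meet because [F] is bounded by [K].
    Otherwise [z] is in the root, and [b] can be replaced by its copy in [F]. *)
Lemma amalgam_witness x y b z : x \in F -> y \in F -> b \in G ->
  (z < x)%O -> (z < y)%O -> (z < b)%O -> r x z = r y z -> r x z <> r b z ->
  meet_next (maxn (r x z) (r b z)) (s x) (s y).
Proof.
move=> xF yF bG zx zy zb xy xb.
have [Kk|] := leqP K (maxn (r x z) (r b z)).
  by apply: (F_bounded xF yF).2.
rewrite gtn_max => /andP[/ltnW xK /ltnW bK].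
have zroot := FG_root xF bG zx zb xK bK.
have [b' b'F [/(_ _ zroot)[zb' bb'] _]] := GF_trace bG.
rewrite bb' in xb *; rewrite zb' in zb.
exact: F_compatible.
Qed.

(** Since [x] and [b] disagree at [z], coherence keeps both values below [K]. So
    [z] is in the root, compatibility of [F] applies to [x], the copy of [y]
    and [b], and its conclusion transfers back to [y] because it only concerns
    naturals below [m]. *)
Lemma amalgam_pair x y b z : x \in F -> y \in G -> b \in F ->
  (z < x)%O -> (z < y)%O -> (z < b)%O -> r x z = r y z -> r x z <> r b z ->
  meet_next (maxn (r x z) (r b z)) (s x) (s y).
Proof.
move=> xF yG bF zx zy zb xy xb.
have kK : maxn (r x z) (r b z) <= K.
  have [lt_xb|lt_bx|xb'] := ltgtP x b; last by rewrite xb' in xb.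
    exact: leq_trans (r_coherent zx lt_xb xb) (F_bounded bF xF).1.
  rewrite maxnC; apply: leq_trans (F_bounded xF bF).1.
  by apply: r_coherent => // /esym.
have xK : r x z <= K by apply: leq_trans kK; exact: leq_maxl.
have zroot : z \in root by apply: (FG_root xF yG) => //; rewrite -xy.
have [y' y'F [/(_ _ zroot)[zy' yy'] tr]] := GF_trace yG.
have : meet_next (maxn (r x z) (r b z)) (s x) (s y').
  by apply: F_compatible => //; rewrite -?zy' -?yy'.
apply: (meet_next_trace (m := m)) => //; try exact: F_next.
by move=> n /tr[]; split.
Qed.

End Amalgamation.

Lemma compatibleU (K m : nat) (root : seq W) (F G : {fset W}) :
  compatible [set` F] -> compatible [set` G] -> bounded_by K F -> bounded_by K G ->
  (forall x k, x \in F -> k <= K -> next (s x) k < m) ->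
  (forall x k, x \in G -> k <= K -> next (s x) k < m) ->
  (forall x y z, x \in F -> y \in G ->
    (z < x)%O -> (z < y)%O -> r x z <= K -> r y z <= K -> z \in root) ->
  (forall y, y \in G -> exists2 y', y' \in F & same_trace root m y y') ->
  (forall y, y \in F -> exists2 y', y' \in G & same_trace root m y y') ->
  compatible [set` (F `|` G)%fset].
Proof.
move=> Fc Gc Fb Gb Fn Gn FG trF trG.
have GF x y z : x \in G -> y \in F ->
    (z < x)%O -> (z < y)%O -> r x z <= K -> r y z <= K -> z \in root.
  by move=> xG yF zx zy xK yK; apply: (FG y x z).
(* Up to exchanging [F] and [G], or [x] and [y], the elements are all in [F], or
   only [b] is in [G], or only [y] is. *)
move=> x y b z; rewrite /= !inE => /orP[]xF /orP[]yF /orP[]bF zx zy zb xy xb.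
- exact: Fc.
- exact: (amalgam_witness Fc Fb FG trF).
- exact: (amalgam_pair Fc Fb Fn FG trF).
- by apply: meet_nextC; rewrite xy in xb *; apply: (amalgam_pair Gc Gb Gn GF trG).
- by apply: meet_nextC; rewrite xy in xb *; apply: (amalgam_pair Fc Fb Fn FG trF).
- exact: (amalgam_pair Gc Gb Gn GF trG).
- exact: (amalgam_witness Gc Gb GF trG).
- exact: Gc.
Qed.

(** [hat p] lists the places where some member of [p] has a value at most the
    bound [K] of [p]; a Delta-system of these is thinned out so that [K], [m]
    and the traces of the members on the root and below [m] are constant. *)
Lemma condition_ccc : ccc condition.
Proof.
have [K KP] := choice bounded_by_ex.
pose m F := (\max_(x <- enum_fset F) \max_(k < (K F).+1) next (s x) k).+1.
have mP (F : {fset W}) x k : x \in F -> k <= K F -> next (s x) k < m F.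
  move=> xF; rewrite -ltnS => kK; rewrite ltnS.
  apply: (leq_trans _ (leq_bigmax_seq x xF isT)).
  exact: (leq_bigmax (Ordinal kK)).
pose low n x := fset_set [set z | (z < x)%O /\ r x z <= n].
have lowP n x z : (z < x)%O -> r x z <= n -> z \in low n x.
  move=> zx xn; rewrite in_fset_set; last exact: r_finite.
  by rewrite inE.
pose hat (p : condition) :=
  flatten [seq enum_fset (low (K (sval p)) x) | x <- enum_fset (sval p)].
move=> A /(uncountable_delta hat)[root [J [JA Juc deltaP]]].
pose trace n x := ([seq ((z < x)%O, r x z) | z <- root],
  [seq `[< s x i >] | i <- iota 0 n]).
have traceP n x y : trace n x = trace n y -> same_trace root n x y.
  move=> [/eq_in_map E1 /eq_in_map E2]; split=> [z /E1[]//|i im].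
  by apply: asbool_eq_equiv; apply: E2; rewrite mem_iota.
pose data (p : condition) :=
  (K (sval p), m (sval p), [seq trace (m (sval p)) x | x <- enum_fset (sval p)]).
have [D] := uncountable_fibre data Juc; set J' := (X in ~ countable X) => J'uc.
have [|p [q [[Jp pD] [Jq qD] pq hatP]]] := deltaP J' _ J'uc; first by move=> x [].
rewrite -{D J' J'uc}pD in qD.
have EK : K (sval p) = K (sval q) := congr1 (fun t => t.1.1) (esym qD).
have Em : m (sval p) = m (sval q) := congr1 (fun t => t.1.2) (esym qD).
have Etr : [seq trace (m (sval p)) x | x <- sval p] =
    [seq trace (m (sval q)) x | x <- sval q] := congr1 snd (esym qD).
exists p, q; split; [exact: JA|exact: JA|exact/eqP|].
have hatE (u : condition) x z : x \in sval u -> (z < x)%O ->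
    r x z <= K (sval u) -> z \in hat u.
  by move=> xu zx xK; apply/flattenP; exists (enum_fset (low (K (sval u)) x));
     [exact: map_f|exact: lowP].
have trpq y : y \in sval q ->
    exists2 y', y' \in sval p & same_trace root (m (sval p)) y y'.
  move=> yq.
  have : trace (m (sval p)) y \in [seq trace (m (sval p)) x | x <- sval p].
    by rewrite Etr -Em; exact: map_f.
  by move=> /mapP[y' y'p /traceP ?]; exists y'.
have trqp y : y \in sval p ->
    exists2 y', y' \in sval q & same_trace root (m (sval p)) y y'.
  move=> yp.
  have : trace (m (sval p)) y \in [seq trace (m (sval q)) x | x <- sval q].
    by rewrite -Etr; exact: map_f.
  by rewrite -Em => /mapP[y' y'q /traceP ?]; exists y'.
have compat (u : condition) : compatible [set` sval u].
  by case: u => F Fc; apply/asboolP.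
have U : compatible [set` (sval p `|` sval q)%fset].
  apply: (@compatibleU (K (sval p)) (m (sval p)) root) => //.
  - by rewrite EK.
  - exact: mP.
  - by move=> x k; rewrite Em EK; exact: mP.
  - by move=> x y z xp yq zx zy xK yK; apply: hatP; [exact: (hatE p x)|
      apply: (hatE q y) => //; rewrite -EK].
have /asboolP Ub := U.
pose u : condition := exist (fun F => `[< compatible [set` F] >]) _ Ub.
by exists u => _ [->|->]; [exact: fsubsetUl|exact: fsubsetUr].
Qed.

End Forcing.

(** * Uncountable compatible sets *)

Lemma card_image3 (T : eqType) (U : Type) (f : T -> U) (x y z : T) :
  injective f -> uniq [:: x; y; z] -> ([set f x; f y; f z] #= `I_3)%card.
Proof.
move=> fI xyz; pose g i := f (nth x [:: x; y; z] i).
have -> : [set f x; f y; f z] = g @` `I_3.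
  apply/seteqP; split=> [_ [[|]|] ->|_ [[|[|[|//]]] _ <-]].
  - by exists 0.
  - by exists 1.
  - by exists 2.
  - by left; left.
  - by left; right.
  - by right.
apply: inj_card_eq => i j; rewrite !inE /= => i3 j3 /fI/eqP.
by rewrite nth_uniq // => /eqP.
Qed.

Section UncountableCompatible.
Context {d : Order.disp_t} {W : orderType d}.
Variables (r : W -> W -> nat) (s : W -> set nat).
Hypothesis W_segment : forall a : W, countable [set x | (x < a)%O].
Hypothesis W_uncountable : ~ countable [set: W].
Hypothesis r_finite : forall a n, finite_set [set z | (z < a)%O /\ r a z <= n].
Hypothesis r_coherent : forall z a b, (z < a)%O -> (a < b)%O ->
  r a z <> r b z -> maxn (r a z) (r b z) <= r b a.
Hypothesis s_infinite : forall a, infinite_set (s a).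
Hypothesis s_decreasing : forall a b, (a < b)%O -> almost_subset (s b) (s a).

Lemma compatible1 (a : W) : compatible r s [set` [fset a]%fset].
Proof. by move=> x y b z /fset1P-> /fset1P-> /fset1P->. Qed.

(** Property K_3 is applied to the singletons: a lower bound of three of them is
    a compatible finite set containing the three indices. *)
Lemma uncountable_compatible_ex : K3_assertion ->
  exists X, compatible r s X /\ ~ countable X.
Proof.
move=> K3; pose cond := condition r s.
pose pt (a : W) : cond :=
  exist (fun F => `[< compatible r s [set` F] >]) [fset a]%fset
    (asboolT (@compatible1 a)).
have ptI : injective pt by move=> a b [] /fset1_inj.
have pt_uc : ~ countable (range pt).
  by rewrite (eq_countable (inj_card_eq (in2W ptI))).
have [X [Xpt Xuc X3]] :=
  K3 _ cond (condition_ccc r_finite r_coherent s_infinite s_decreasing) _ pt_uc.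
exists (pt @^-1` X); split; last first.
  move=> /(fun h => sub_countable (card_image_le pt _) h) H; apply: Xuc.
  apply: subset_countable H => p Xp; have [a _ ap] := Xpt _ Xp.
  by exists a => //; rewrite /preimage /= ap.
move=> x y b z Xx Xy Xb zx zy zb xy xb.
have [->|nxy] := eqVneq x y; first exact: (meet_next_refl _ (@s_infinite _)).
have nxb : x != b by apply: contra_not_neq xb => ->.
have nyb : y != b by apply: contra_not_neq xb => <-.
have xyb : uniq [:: x; y; b] by rewrite /= !inE negb_or nxy nxb nyb.
have [|q qP] := X3 [set pt x; pt y; pt b] _ (card_image3 ptI xyb).
  by move=> _ [[->|->]|->].
have mem a : [set pt x; pt y; pt b] (pt a) -> a \in sval q.
  by move=> /qP /fsubsetP; apply; rewrite inE.
have /asboolP qc : `[< compatible r s [set` sval q] >] by case: (q).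
by apply: qc => //; apply: mem; [left; left|left; right|right].
Qed.

Lemma countable_bounded (C : set W) :
  countable C -> exists a, forall x, C x -> (x < a)%O.
Proof.
move=> Cc; apply: contra_notP W_uncountable => /forallNP H.
apply: (@subset_countable _ _ (\bigcup_(x in C) ([set y | (y < x)%O] `|` [set x]))).
  move=> a _; have /existsNP[x /not_implyP[Cx /negP]] := H a.
  by rewrite -leNgt le_eqVlt => /predU1P[->|ax]; exists x => //; [right|left].
apply: bigcup_countable => // x _; apply: countable_setU; first exact: W_segment.
exact: countable1.
Qed.

Lemma sequence_bounded (f : nat -> W) : exists a, forall n, (f n < a)%O.
Proof.
have [a fa] := countable_bounded
  (sub_countable (card_image_le f setT) (countableP (setT : set nat))).
by exists a => n; apply: fa; exists n.
Qed.

Lemma uncountable_above (X : set W) (a : W) :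
  ~ countable X -> ~ countable [set x | X x /\ (a < x)%O].
Proof.
move=> Xuc /countable_setU /(_ (countable_setU (W_segment a) (countable1 a))) H.
apply: Xuc; apply: subset_countable H => x Xx.
by have [xa|ax|->] := ltgtP x a; [right; left|left|right; right].
Qed.

(** Were [B] finite, a single function [z |-> r (b z) z], independent of the
    choice of [b z] in [X], would be defined outside [B]. It is constant on an
    uncountable set, hence on an infinite set of places below some [c] in [X],
    where it coincides with the finite-to-one [r c]. *)
Lemma infinite_splitting (X : set W) : ~ countable X ->
  infinite_set [set z | exists b c,
    [/\ X b, X c, (z < b)%O, (z < c)%O & r b z <> r c z]].
Proof.
move=> Xuc; set B := [set z | _] => Bfin.
have above z : exists b, X b /\ (z < b)%O.
  by have [b [Xb zb]] := uncountable_neq0 (uncountable_above (a := z) Xuc); exists b.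
have [b bP] := choice above.
have BCuc := uncountable_setD W_uncountable (finite_set_countable Bfin).
have [n nuc] := uncountable_fibre (fun z => r (b z) z) BCuc.
have /infinite_enum[f [fI fP]] :
    infinite_set [set z | ([set: W] `\` B) z /\ r (b z) z = n].
  by move=> /finite_set_countable.
have [a fa] := sequence_bounded f.
have [c [Xc ac]] := uncountable_neq0 (uncountable_above (a := a) Xuc).
apply: (injective_infinite fI _ (r_finite c n)) => i.
have [[_ fB] rn] := fP i; have [Xb fb] := bP (f i).
have fc : (f i < c)%O := lt_trans (fa i) ac.
split=> //; rewrite -rn leqNgt; apply/negP => lt_r; apply: fB.
by exists (b (f i)), c; split=> // E; rewrite E ltnn in lt_r.
Qed.

(** On the set of [x] in [X] above [a] for which [r x a] has a fixed value [j],
    coherence with [r a] forces [r x z = r a z] as soon as [r a z > j]. At a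
    place [z] of disagreement in [X], compatibility then gives one [k], at least
    [r a z], that serves all pairs. *)
Lemma compatible_meets (X : set W) : compatible r s X -> ~ countable X ->
  exists Y : set W, ~ countable Y /\
    forall N, exists2 k, N <= k & forall x y, Y x -> Y y -> meet_next k (s x) (s y).
Proof.
move=> Xcomp Xuc.
have [f [fI fP]] := infinite_enum (infinite_splitting Xuc).
have [a fa] := sequence_bounded f.
have [j Yuc] := uncountable_fibre (fun x => r x a) (uncountable_above (a := a) Xuc).
exists [set x | (X x /\ (a < x)%O) /\ r x a = j]; split=> // N.
(* Infinitely many places of disagreement lie below [a], and [r a] is
   finite-to-one, so it takes large values on them. *)
have [n nN] : exists n, maxn N j < r a (f n).
  apply: contrapT => /forallNP H.
  apply: (injective_infinite fI _ (r_finite a (maxn N j))) => n.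
  by split=> //; rewrite leqNgt; apply/negP/H.
have /andP[Nr jr] : (N < r a (f n)) && (j < r a (f n)) by rewrite -gtn_max.
have rY x : X x -> (a < x)%O -> r x a = j -> r x (f n) = r a (f n).
  move=> Xx ax xj; apply: contrapT => /nesym neq.
  by have := r_coherent (fa n) ax neq; rewrite xj; lia.
have [b [Xb fb rb]] : exists b, [/\ X b, (f n < b)%O & r b (f n) <> r a (f n)].
  have [b [c [Xb Xc zb zc bc]]] := fP n.
  have [E|] := eqVneq (r b (f n)) (r a (f n)); last by move=> /eqP ?; exists b.
  by exists c; split=> //; rewrite -E; exact/nesym.
exists (maxn (r a (f n)) (r b (f n))); first by lia.
move=> x y [[Xx ax] xj] [[Xy ay] yj]; rewrite -(rY x) //.
have fx := lt_trans (fa n) ax; have fy := lt_trans (fa n) ay.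
by apply: Xcomp => //; rewrite (rY x) // ?(rY y) //; exact/nesym.
Qed.

End UncountableCompatible.

(** Let [V k] be the set of all [next (s i) k]. If the pairs meet at [k] and [V k]
    is infinite, it is itself a pseudo-intersection: past [next (s i) k], its
    elements are in [s i]. If [V k] is finite, its largest element is in every
    [s i]; if this happens for all such [k], the plain intersection is
    infinite. *)
Lemma pseudo_intersection_of_meets (I : Type) (s : I -> set nat) (Y : set I) (i0 : I) :
  (forall i, infinite_set (s i)) -> Y i0 ->
  (forall N, exists2 k, N <= k & forall x y, Y x -> Y y -> meet_next k (s x) (s y)) ->
  exists2 J, infinite_set J & forall i, Y i -> almost_subset J (s i).
Proof.
move=> s_inf Y0 meets.
pose V k := [set next (s i) k | i in Y].
have [[k [Vinf kY]]|Vfin] := pselect (exists k, infinite_set (V k) /\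
    forall x y, Y x -> Y y -> meet_next k (s x) (s y)).
  exists (V k) => // i Yi.
  apply: (@sub_finite_set _ _ `I_(next (s i) k)); last exact: finite_II.
  move=> _ [[j Yj <-] sij] /=; rewrite ltnNge; apply/negP => le_ij; apply: sij.
  by have [] := kY i j Yi Yj; rewrite (maxn_idPr le_ij).
exists [set q | forall i, Y i -> s i q]; last first.
  move=> i Yi; apply: (sub_finite_set (B := set0)) => // q [qY]; apply; exact: qY.
apply/infinite_natP => N; have [k Nk kY] := meets N.
have /finite_seqP[l Vl] : finite_set (V k).
  by apply: contrapT => Vinf; apply: Vfin; exists k.
have Vmem i : Y i -> next (s i) k \in l.
  by move=> Yi; have : V k (next (s i) k); [exists i|rewrite Vl].
have [i Yi imax] : exists2 i, Y i & forall j, Y j -> next (s j) k <= next (s i) k.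
  have ex : exists n, `[< V k n >] by exists (next (s i0) k); apply/asboolP; exists i0.
  have bd n : `[< V k n >] -> n <= \max_(m <- l) m.
    move=> /asboolP[j Yj <-].
    exact: (@leq_bigmax_seq _ l xpredT id _ (Vmem _ Yj) isT).
  case: (ex_maxnP ex bd) => _ /asboolP[i Yi <-] imax; exists i => // j Yj.
  by apply: imax; apply/asboolP; exists j.
have [ki _ _] := nextP k (@s_inf i).
exists (next (s i) k); first exact: leq_trans Nk ki.
by move=> j Yj; have [] := kY j i Yj Yi; rewrite (maxn_idPr (imax _ Yj)).
Qed.

(** By comparability, one of the first [n] sets is almost contained in the other
    ones, so their intersection is infinite; pick an element of it beyond [n]. *)
Lemma countable_pseudo_intersection (u : nat -> set nat) :
  (forall n, infinite_set (u n)) ->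
  (forall m n, almost_subset (u m) (u n) \/ almost_subset (u n) (u m)) ->
  exists2 J, infinite_set J & forall n, almost_subset J (u n).
Proof.
move=> u_inf u_tot.
have least n : exists i, forall j, j <= n -> almost_subset (u i) (u j).
  elim: n => [|n [i iP]].
    by exists 0 => j; rewrite leqn0 => /eqP->; exact: almost_subset_refl.
  have [H|H] := u_tot i n.+1.
    by exists i => j; rewrite leq_eqVlt ltnS => /predU1P[->//|/iP].
  exists n.+1 => j; rewrite leq_eqVlt ltnS => /predU1P[->|/iP].
    exact: almost_subset_refl.
  exact: almost_subset_trans.
have p_ex n : exists p, n <= p /\ forall j, j <= n -> u j p.
  have [i iP] := least n.
  have fin : finite_set (\bigcup_(j in `I_n.+1) (u i `\` u j)).
    by apply: bigcup_finite => [|j]; [exact: finite_II|exact: iP].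
  have /infinite_natP/(_ n)[p np [uip up]] := infinite_setD (@u_inf i) fin.
  exists p; split=> // j jn; apply: contrapT => ujp; apply: up.
  by exists j; rewrite //= ltnS.
have [p pP] := choice p_ex; exists (range p).
  by apply/infinite_natP => N; exists (p N); [exact: (pP N).1|exists N].
move=> n; apply: (@sub_finite_set _ _ (p @` `I_n)); last exact/finite_image/finite_II.
move=> _ [[m _ <-] nup]; exists m => //=.
by rewrite ltnNge; apply/negP => nm; apply: nup; exact: (pP m).2.
Qed.

(** * Sequences indexed by omega_1 *)

Section Towers.
Context {d : Order.disp_t} {W : orderType d}.
Hypothesis W_wf : well_founded (fun x y : W => (x < y)%O).
Hypothesis W_segment : forall a : W, countable [set x | (x < a)%O].
Hypothesis W_uncountable : ~ countable [set: W].
Hypothesis K3 : K3_assertion.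

Lemma decreasing_pseudo_intersection (s : W -> set nat) :
  (forall a, infinite_set (s a)) ->
  (forall a b, (a < b)%O -> almost_subset (s b) (s a)) ->
  exists2 J, infinite_set J & forall a, almost_subset J (s a).
Proof.
move=> s_inf s_dec.
have [r [r_fin r_coh]] := coherent_finite_to_one W_wf W_segment.
have [X [Xcomp Xuc]] :=
  uncountable_compatible_ex W_uncountable r_fin r_coh s_inf s_dec K3.
have [Y [Yuc Ymeets]] :=
  compatible_meets W_segment W_uncountable r_fin r_coh Xcomp Xuc.
have [i0 Yi0] := uncountable_neq0 Yuc.
have [J Jinf JY] := pseudo_intersection_of_meets s_inf Yi0 Ymeets.
exists J => // a.
have [b [Yb ab]] := uncountable_neq0 (uncountable_above W_segment (a := a) Yuc).
exact: almost_subset_trans (JY _ Yb) (s_dec _ _ ab).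
Qed.

Lemma wf_least (P : set W) : P !=set0 -> exists2 a, P a & forall b, P b -> (a <= b)%O.
Proof.
move=> [a Pa]; elim/(well_founded_ind W_wf) : a Pa => a IH Pa.
have [[b ba Pb]|H] := pselect (exists2 b, (b < a)%O & P b); first exact: IH ba Pb.
by exists a => // b Pb; rewrite leNgt; apply/negP => ba; apply: H; exists b.
Qed.

(** If some initial segment of [g] is coinitial, it is countable and a diagonal
    argument applies. Otherwise, let [l c] be the first index whose set has no
    almost subset among those before [c]; the sequence [g \o l] is decreasing,
    and coinitial. *)
Lemma comparable_pseudo_intersection (g : W -> set nat) :
  (forall a, infinite_set (g a)) ->
  (forall a b, almost_subset (g a) (g b) \/ almost_subset (g b) (g a)) ->
  exists2 J, infinite_set J & forall a, almost_subset J (g a).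
Proof.
move=> g_inf g_tot.
pose low c a := forall b, (b < c)%O -> ~ almost_subset (g b) (g a).
have [[c cP]|ncoi] := pselect (exists c, forall a, ~ low c a).
  have coi a : exists2 b, (b < c)%O & almost_subset (g b) (g a).
    by have /existsNP[b /not_implyP[bc /contrapT ba]] := cP a; exists b.
  have /countable_injP[f fI] := W_segment c.
  (* Naturals outside the range of [f] may be sent to [c] itself, because all
     members of [g] are comparable. *)
  have enum n : exists b, forall b', (b' < c)%O -> f b' = n -> b = b'.
    have [[b bc bn]|nb] := pselect (exists2 b, (b < c)%O & f b = n).
      by exists b => b' b'c b'n; apply: fI; rewrite ?inE // b'n.
    by exists c => b' b'c b'n; case: nb; exists b'.
  have [e eP] := choice enum.
  have [||J Jinf JP] := @countable_pseudo_intersection (g \o e).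
  - by move=> n; exact: g_inf.
  - by move=> m n; exact: g_tot.
  exists J => // a; have [b bc ba] := coi a.
  by apply: almost_subset_trans ba; have := JP (f b); rewrite /= (eP _ b).
have low_ex c : exists a, low c a /\ forall b, low c b -> (a <= b)%O.
  have [|a la amin] := @wf_least [set a | low c a]; last by exists a.
  apply: contrapT => /forallNP H; apply: ncoi; exists c => a; exact: H.
have [l lP] := choice low_ex.
have low_le a c b : low c b -> (a < c)%O -> almost_subset (g b) (g a).
  by move=> lb ac; have [/lb|] := g_tot a b.
have [||J Jinf JP] := @decreasing_pseudo_intersection (g \o l).
- by move=> a; exact: g_inf.
- move=> a b ab /=.
  have : (l a <= l b)%O.
    by apply: (lP a).2 => c ca; apply: (lP b).1; exact: lt_trans ca ab.
  rewrite le_eqVlt => /predU1P[->|lab]; first exact: almost_subset_refl.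
  have : ~ low b (l a) by move=> /(lP b).2; rewrite leNgt lab.
  (* [l a] comes before [l b] by minimality, and fails to be low for [b]. *)
  move=> /existsNP[c /not_implyP[cb /contrapT cla]].
  by apply: almost_subset_trans cla; apply: low_le cb; exact: (lP b).1.
exists J => // a.
have [c [_ ac]] :=
  uncountable_neq0 (uncountable_above W_segment (a := a) W_uncountable).
by apply: almost_subset_trans (JP c) _; apply: low_le ac; exact: (lP c).1.
Qed.

End Towers.

(** * Cardinals as ordered types *)

Section OrderOfCardinal.
Variable k : cardinal.

(** A copy of [k] to which order structures are attached. *)
Definition carrier : Type := csort k.

HB.instance Definition _ := gen_eqMixin carrier.
HB.instance Definition _ := gen_choiceMixin carrier.

Lemma carrier_refl : reflexive (@cle k : rel carrier).
Proof. by move=> x; have := well_order_total (@cle_wo k) x x; rewrite orbb. Qed.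

Lemma carrier_anti : antisymmetric (@cle k : rel carrier).
Proof. exact: (well_order_anti (@cle_wo k)). Qed.

Lemma carrier_trans : transitive (@cle k : rel carrier).
Proof.
move=> y x z xy yz.
have [|w [[->|->]|->] wP] := @well_order_min _ _ [set x; y; z] (@cle_wo k).
- by exists x; left; left.
- by apply: wP; right.
- suff -> : x = y by [].
  by apply: carrier_anti; rewrite xy wP //; left; left.
- suff <- : y = z by [].
  by apply: carrier_anti; rewrite yz wP //; left; right.
Qed.

HB.instance Definition _ := Order.Le_isPOrder.Build (Order.Disp tt tt) carrier
  carrier_refl carrier_anti carrier_trans.

HB.instance Definition _ := Order.POrder_isTotal.Build (Order.Disp tt tt) carrier
  (well_order_total (@cle_wo k)).

Lemma carrier_ltE (a b : carrier) : (a < b)%O = strict_part (@cle k) a b.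
Proof. by rewrite ltNge. Qed.

Lemma carrier_wf : well_founded (fun a b : carrier => (a < b)%O).
Proof.
move=> a; apply: contrapT => na.
have [|b nb bmin] := @well_order_min _ _
  [set a | ~ Acc (fun a b : carrier => (a < b)%O) a] (@cle_wo k).
  by exists a.
apply: nb; split=> c; rewrite carrier_ltE /strict_part => /negP bc.
by apply: contrapT => nc; apply: bc; exact: bmin.
Qed.

End OrderOfCardinal.

Lemma omega1_uncountable : ~ countable [set: carrier omega1].
Proof. by rewrite /carrier /omega1; case: cid => m []. Qed.

(** An uncountable initial segment would have the size of an uncountable
    cardinal, into which omega_1 injects by minimality, although it does not
    inject into its proper initial segments. *)
Lemma omega1_segment (a : carrier omega1) : countable [set x | (x < a)%O].
Proof.
apply: contrapT => auc.
have [k kE] := cardinal_of {x | (x < a)%O}.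
have {}kE := card_eq_trans kE (Defs.card_sig _).
have kuc : ~ countable [set: k] by rewrite (eq_countable kE).
have [_ omega1P] := svalP (cid (least_cardinal_ex uncountable_cardinal_ex)).
have : ([set: omega1] #<= [set: k])%card by exact: omega1P.
rewrite (card_le_eqr kE) => le_a; apply: (@cle_initial omega1 a).
apply: card_le_trans le_a _; apply: subset_card_le => x.
by rewrite /= carrier_ltE.
Qed.

Theorem theorem11 : K3_assertion -> cardinal_lt omega1 tower_number.
Proof.
move=> K3.
suff nle : ~ ([set: tower_number] #<= [set: omega1])%card.
  by split=> //; have [] := card_le_total omega1 tower_number.
have [[k [t [[t_inf t_dec] t_unfilled tE]]] _] :=
  svalP (cid (least_cardinal_ex unfilled_tower_size_ex)).
rewrite -/tower_number in tE.
rewrite (card_le_eql tE) => t_le; apply: t_unfilled.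
have t_tot a b : almost_subset (t a) (t b) \/ almost_subset (t b) (t a).
  have [ab|ba|->] := @ltgtP _ (carrier k) a b.
  - by right; apply: t_dec; rewrite -carrier_ltE.
  - by left; apply: t_dec; rewrite -carrier_ltE.
  - by left; exact: almost_subset_refl.
(* The empty tower is filled; a member [t a0] is needed as a default value. *)
have [[a0 _]|k0] := pselect ([set: k] !=set0); last first.
  exists setT; first exact: infinite_nat.
  by move=> a; case: k0; exists a.
have /pcard_surjP[h hP] := t_le.
pose g (w : carrier omega1) := if pselect (range t (h w)) then h w else t a0.
have g_range w : range t (g w) by rewrite /g; case: pselect => // _; exists a0.
have [||J Jinf JP] := comparable_pseudo_intersection (@carrier_wf omega1)
  omega1_segment omega1_uncountable K3 (g := g).
- by move=> w; have [a _ <-] := g_range w; exact: t_inf.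
- by move=> w v; have [a _ <-] := g_range w; have [b _ <-] := g_range v; exact: t_tot.
exists J => // a; have [|w _ hw] := hP (t a); first by exists a.
suff <- : g w = t a by exact: JP.
by rewrite /g hw; case: pselect => // -[]; exists a.
Qed.
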